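(* Let $(\Omega,\Sigma,\mu)$ be a finite measure space. Let $E_0,E_1$ be Banach spaces with $E_0\subset E_1$ and let $Y_0(\mu)$, $Y_1(\mu)$ be Banach function spaces over $\mu$. Assume that $\overline E=(E_0,E_1)$ and $\overline Y=(Y_0(\mu),Y_1(\mu))$ are Banach couples. Let $\phi_i:\Sigma\to\mathbb R^+$, $i=0,1$, be increasing set functions. Suppose that $T:E_1\to Y_1(\mu)$ is a map (not assumed linear) satisfying the following properties: (a) $T(E_0)\subset Y_0(\mu)$ and $\|T(x)\chi_A\|_{Y_0}\le\phi_0(A)\|x\|_{E_0}$ for all $A\in\Sigma$ and $x\in E_0$; (b) $\|(T(x)-T(y))\chi_A\|_{Y_1}\le\phi_1(A)\|x-y\|_{E_1}$ for all $A\in\Sigma$ and $x,y\in E_1$. Let $\theta\in(0,1)$ and $p\in[1,\infty)$. Then $T:\overline E_{\theta,p}\to\overline Y_{\theta,p}$ is a well-defined map, and $$\|T(x)\chi_A\|_{\overline Y_{\theta,p}}\le\phi_0(A)^{1-\theta}\phi_1(A)^\theta\|x\|_{\overline E_{\theta,p}},\quad x\in\overline E_{\theta,p},\ A\in\Sigma.$$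
   Context: $L^0(\mu)$ is the space of classes of $\mu$-a.e. equal measurable functions. A Banach function space $Y(\mu)$ is a linear ideal of $L^0(\mu)$ with a complete norm such that if $f\in L^0(\mu)$, $|f|\le g$ and $g\in Y(\mu)$ then $f\in Y(\mu)$ and $\|f\|_{Y(\mu)}\le\|g\|_{Y(\mu)}$, and which contains the characteristic functions of sets of finite measure. A set function $\phi:\Sigma\to\mathbb R^+=[0,\infty)$ is increasing if $\phi(B)\le\phi(A)$ whenever $B\subseteq A$ in $\Sigma$ (so it is bounded by $\phi(\Omega)$). For an interpolation couple of Banach spaces $\overline E=(E_0,E_1)$, $t>0$ and $a\in E_0+E_1$, let $$K(t,a;E_0,E_1)=\inf\{\|a_0\|_{E_0}+t\|a_1\|_{E_1}: a=a_0+a_1,\ a_0\in E_0,\ a_1\in E_1\}.$$ For $\theta\in(0,1)$ and $p\in[1,\infty)$, $\overline E_{\theta,p}$ is the set of $a\in E_0+E_1$ for which $$\|a\|_{\overline E_{\theta,p}}=\Big(\int_0^\infty\big(t^{-\theta}K(t,a;E_0,E_1)\big)^p\,\frac{dt}{t}\Big)^{1/p}<\infty,$$ with this norm; $\overline Y_{\theta,p}$ is defined in the same way from $\overline Y$. *)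

(* Defs.v *)
From HB Require Import structures.
From mathcomp Require Import all_boot all_order all_algebra.
From mathcomp Require Import all_classical all_reals all_analysis.
From mathcomp Require Import measurable_realfun.

Set Implicit Arguments.
Unset Strict Implicit.
Unset Printing Implicit Defensive.
Import Order.TTheory GRing.Theory Num.Theory.
Import numFieldNormedType.Exports.

Local Open Scope classical_set_scope.
Local Open Scope ring_scope.

Section L0.
Context d (T : measurableType d) (R : realType).
Variable mu : {measure set T -> \bar R}.
Local Open Scope quotient_scope.

(* The vector space L^0(mu). The library has the quotient of measurable
   functions by mu-a.e. equality, but not its algebraic structure. *)
Definition L0 : Type := {mfun_ mu, T >-> R}.
HB.instance Definition _ := Choice.on L0.
HB.instance Definition _ := EqQuotient.on L0.

Definition L0_fun (f : L0) : {mfun T >-> R} := repr f.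
Coercion L0_fun : L0 >-> MeasurableFun.type.

Definition L0_class (f : {mfun T >-> R}) : L0 := \pi f.

Lemma L0_classP (f g : {mfun T >-> R}) :
  L0_class f = L0_class g <-> {ae mu, forall x, f x = g x}.
Proof.
split=> [/eqmodP/asboolP fg|fg].
  by apply: filterS fg => x; exact.
by apply/eqmodP/asboolP; apply: filterS fg => x ? _.
Qed.

Lemma L0_funK : cancel L0_fun L0_class.
Proof. exact: reprK. Qed.

Lemma L0_classK (f : {mfun T >-> R}) : {ae mu, forall x, L0_class f x = f x}.
Proof. by apply/L0_classP; rewrite L0_funK. Qed.

Definition L0_zero : L0 := L0_class 0.
Definition L0_opp (f : L0) : L0 := L0_class (- (f : {mfun T >-> R})).
Definition L0_add (f g : L0) : L0 :=
  L0_class ((f : {mfun T >-> R}) + (g : {mfun T >-> R})).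
Definition L0_scale (a : R) (f : L0) : L0 :=
  L0_class (a *: (f : {mfun T >-> R})).
Definition L0_mul (f g : L0) : L0 :=
  L0_class ((f : {mfun T >-> R}) * (g : {mfun T >-> R})).

Lemma L0_ext (f g : L0) : {ae mu, forall x, f x = g x} -> f = g.
Proof. by move=> fg; rewrite -(L0_funK f) -(L0_funK g); apply/L0_classP. Qed.

Lemma L0_zeroE : {ae mu, forall x, L0_zero x = 0}.
Proof. exact: L0_classK. Qed.

Lemma L0_oppE f : {ae mu, forall x, L0_opp f x = - f x}.
Proof. exact: L0_classK. Qed.

Lemma L0_addE f g : {ae mu, forall x, L0_add f g x = f x + g x}.
Proof. exact: L0_classK. Qed.

Lemma L0_scaleE a f : {ae mu, forall x, L0_scale a f x = a * f x}.
Proof. exact: L0_classK. Qed.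

Lemma L0_mulE f g : {ae mu, forall x, L0_mul f g x = f x * g x}.
Proof. exact: L0_classK. Qed.

Lemma L0_addA : associative L0_add.
Proof.
move=> f g h; apply: L0_ext.
near=> x.
have -> : L0_add f (L0_add g h) x = f x + L0_add g h x.
  by near: x; exact: L0_addE.
have -> : L0_add (L0_add f g) h x = L0_add f g x + h x.
  by near: x; exact: L0_addE.
have -> : L0_add g h x = g x + h x by near: x; exact: L0_addE.
have -> : L0_add f g x = f x + g x by near: x; exact: L0_addE.
by rewrite addrA.
Unshelve. all: by end_near. Qed.

Lemma L0_addC : commutative L0_add.
Proof. by move=> f g; rewrite /L0_add addrC. Qed.

Lemma L0_add0 : left_id L0_zero L0_add.
Proof.
move=> f; apply: L0_ext.
apply: filterS2 (L0_addE L0_zero f) L0_zeroE => x -> ->.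
by rewrite add0r.
Qed.

Lemma L0_addN : left_inverse L0_zero L0_opp L0_add.
Proof.
move=> f; apply: L0_ext.
apply: filterS3 (L0_addE (L0_opp f) f) (L0_oppE f) L0_zeroE => x -> -> ->.
by rewrite addNr.
Qed.

HB.instance Definition _ :=
  GRing.isZmodule.Build L0 L0_addA L0_addC L0_add0 L0_addN.

Lemma L0_scaleA a b f : L0_scale a (L0_scale b f) = L0_scale (a * b) f.
Proof.
apply: L0_ext.
apply: filterS3 (L0_scaleE a (L0_scale b f)) (L0_scaleE b f)
  (L0_scaleE (a * b) f) => x -> -> ->.
by rewrite mulrA.
Qed.

Lemma L0_scale1 : left_id 1 L0_scale.
Proof. by move=> f; rewrite /L0_scale scale1r L0_funK. Qed.

Lemma L0_scaleDr : right_distributive L0_scale +%R.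
Proof.
move=> a f g; apply: L0_ext.
near=> x.
have -> : L0_scale a (f + g) x = a * L0_add f g x.
  by near: x; exact: L0_scaleE.
have -> : (L0_scale a f + L0_scale a g : L0) x = L0_scale a f x + L0_scale a g x.
  by near: x; exact: L0_addE.
have -> : L0_add f g x = f x + g x by near: x; exact: L0_addE.
have -> : L0_scale a f x = a * f x by near: x; exact: L0_scaleE.
have -> : L0_scale a g x = a * g x by near: x; exact: L0_scaleE.
by rewrite mulrDr.
Unshelve. all: by end_near. Qed.

Lemma L0_scaleDl f : {morph L0_scale^~ f : a b / a + b}.
Proof.
move=> a b; apply: L0_ext.
near=> x.
have -> : L0_scale (a + b) f x = (a + b) * f x.
  by near: x; exact: L0_scaleE.
have -> : (L0_scale a f + L0_scale b f : L0) x = L0_scale a f x + L0_scale b f x.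
  by near: x; exact: L0_addE.
have -> : L0_scale a f x = a * f x by near: x; exact: L0_scaleE.
have -> : L0_scale b f x = b * f x by near: x; exact: L0_scaleE.
by rewrite mulrDl.
Unshelve. all: by end_near. Qed.

HB.instance Definition _ := GRing.Zmodule_isLmodule.Build R L0
  L0_scaleA L0_scale1 L0_scaleDr L0_scaleDl.

Definition L0_indic (A : set T) (mA : measurable A) : L0 :=
  L0_class (mindic R mA).

End L0.

Arguments L0 {d T R} mu.
Arguments L0_class {d T R} mu f.
Arguments L0_indic {d T R} mu {A} mA.

(* A Banach space contained as a vector space in V, with a norm of its own, is
   a complete normed space X with an injective linear map j : X -> V. *)

(* "f belongs to X and its norm there is at most c", for f in V. *)
Definition norm_le (R : realType) (X : completeNormedModType R)
    (V : lmodType R) (j : {linear X -> V}) (f : V) (c : R) : Prop :=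
  exists2 y : X, j y = f & `|y| <= c.

Definition banach_function_space d (T : measurableType d) (R : realType)
    (mu : {measure set T -> \bar R}) (Y : completeNormedModType R)
    (j : {linear Y -> L0 mu}) : Prop :=
  [/\ injective j,
      forall (f : L0 mu) (g : Y), {ae mu, forall x, `|f x| <= (j g : L0 mu) x} ->
        norm_le j f `|g|
    & forall (A : set T) (mA : measurable A), (mu A < +oo)%E ->
        range j (L0_indic mu mA)].

Section couple.
Context (R : realType) (X0 X1 : completeNormedModType R) (V : lmodType R).
Variables (j0 : {linear X0 -> V}) (j1 : {linear X1 -> V}).

Definition sum_space : set V := [set j0 u.1 + j1 u.2 | u in [set: X0 * X1]].

(* V only fixes the vector space structure of X0 + X1; compatibility is
   continuous inclusion in a common Hausdorff topological vector space W, which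
   need not be locally convex (as the library's tvsType is). *)
Definition banach_couple : Prop :=
  [/\ injective j0, injective j1 &
      exists (W : topologicalLmodType R) (k : {linear V -> W}),
        [/\ hausdorff_space W,
            {in sum_space &, injective k},
            continuous (k \o j0)
          & continuous (k \o j1)]].

Definition K_functional (t : R) (a : V) : R :=
  inf [set `|u.1| + t * `|u.2| | u in
        [set u : X0 * X1 | j0 u.1 + j1 u.2 = a]].

Definition interp_norm (theta p : R) (a : V) : \bar R :=
  ((\int[lebesgue_measure]_(t in `]0%R, +oo[)
     ((t `^ (- theta) * K_functional t a) `^ p / t)%:E) `^ p^-1)%E.

Definition interp_space (theta p : R) : set V :=
  [set a | sum_space a /\ (interp_norm theta p a < +oo)%E].

End couple.

Definition increasing_set_function d (T : measurableType d) (R : realType)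
    (phi : set T -> R) : Prop :=
  (forall A, measurable A -> 0 <= phi A) /\
  (forall A B, measurable A -> measurable B -> B `<=` A -> phi B <= phi A).

(* Main.v *)
Require Import Defs.
From HB Require Import structures.
From mathcomp Require Import all_boot all_order all_algebra.
From mathcomp Require Import all_classical all_reals all_analysis.
From mathcomp Require Import measurable_realfun.
From mathcomp Require Import ring.
Import Order.TTheory GRing.Theory Num.Theory.
Import numFieldNormedType.Exports.
Local Open Scope classical_set_scope.
Local Open Scope ring_scope.

(** The K-functional of T x restricted to A is controlled by that of x, even
though T is not linear.  A decomposition x = x0 + x1 gives
[[
  T x chi_A = T x0 chi_A + (T x - T x0) chi_A,
]]
where by (a) the first summand has norm at most phi0 A * |x0| in Y0 and, since
x - x0 = x1, by (b) the second has norm at most phi1 A * |x1| in Y1.  Taking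
the infimum over the decompositions, for m0 = phi0 A > 0 and m1 = phi1 A,
[[
  K(t, T x chi_A) <= m0 K((m1 / m0) t, x).
]]
If m1 > 0 as well, the substitution s = (m1 / m0) t, under which dt / t is
invariant, turns t^(-theta) into (m1 / m0)^theta s^(-theta), so that the
interpolation norm is multiplied by m0 (m1 / m0)^theta = m0^(1-theta) m1^theta.

The substitution fails when m0 or m1 vanishes.  But the bounds on the two
summands remain true when m0 and m1 are increased, so the norm inequality
holds for all larger positive constants; as the norm of x is finite, these
may tend to m0 and m1.  This is [interp_norm_transfers], which is stated for
two arbitrary couples and only refers to how decompositions are carried over.

The whole estimate applies to T x itself, since T x = T x chi_Omega. *)

(** * Dilation of the Lebesgue measure *)

Section dilation.
Context {R : realType}.
Local Notation mu := (@lebesgue_measure R).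

(** Multiplication by c, with both sides given the type on which the Lebesgue
measure is declared, so that the image measure can be formed. *)
Definition dilate (c : R) : measurableTypeR R -> measurableTypeR R := *%R c.

Lemma measurable_dilate c : measurable_fun setT (dilate c).
Proof. exact: mulrl_measurable. Qed.

(** By uniqueness of the Lebesgue measure it suffices to look at half-open
intervals, whose preimages have their endpoints divided by c. *)
Lemma lebesgue_measure_dilate (c : {nonneg R}) (A : set R) :
  0 < c%:num -> measurable A ->
  (c%:num%:E * mu (dilate c%:num @^-1` A))%E = mu A.
Proof.
move=> c0 mA.
pose nu := mscale c (pushforward mu (dilate c%:num)).
rewrite -[LHS]/(nu (measurable_dilate _) A).
apply/esym/lebesgue_measure_unique => //= _ [[a b]] _ <-.
rewrite /nu /= /mscale/= /pushforward.
have -> : dilate c%:num @^-1` [set` `]a, b]] =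
    `](c%:num^-1 * a), (c%:num^-1 * b)]%classic.
  apply/seteqP; split => x /=; rewrite /dilate !in_itv/=;
  by rewrite ltr_pdivrMl// ler_pdivlMl.
rewrite !lebesgue_measure_itv/= !lte_fin ltr_pM2l ?invr_gt0//.
case: ifPn => _; last by rewrite mule0.
by rewrite -!EFinD -EFinM -mulrBr mulVKf// gt_eqF.
Qed.

(** The half-line is stable under multiplication by c, and the image of the
Lebesgue measure under it is the Lebesgue measure divided by c. *)
Lemma ge0_integral_dilate (c : R) (f : R -> \bar R) : 0 < c ->
  measurable_fun (`]0, +oo[%classic : set R) f ->
  (forall t, 0 < t -> (0 <= f t)%E) ->
  (c%:E * \int[mu]_(t in `]0%R, +oo[) f (c * t)%R)%E =
  (\int[mu]_(t in `]0%R, +oo[) f t)%E.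
Proof.
move=> c0 mf f0.
have cpre : dilate c @^-1` `]0%R, +oo[ = `]0%R, +oo[%classic.
  apply/seteqP; split => x /=; rewrite /dilate !in_itv/= !andbT;
  by rewrite pmulr_rgt0.
have f0' y : `]0, +oo[%classic y -> (0 <= f y)%E.
  by rewrite /= in_itv/= andbT; exact: f0.
pose image_measure : {measure set (measurableTypeR R) -> \bar R} :=
  pushforward mu (dilate c).
pose nu := image_measure (measurable_dilate c).
pose k : {nonneg R} := NngNum (ltW c0).
transitivity (k%:num%:E * \int[nu]_(t in `]0%R, +oo[) f t)%E.
  rewrite -[in LHS]cpre ge0_integral_pushforward//.
  - exact: measurable_dilate.
  - by move=> y; rewrite inE; exact: f0'.
rewrite -ge0_integral_mscale//.
apply: eq_measure_integral => A mA _.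
exact: (@lebesgue_measure_dilate k).
Qed.

End dilation.

(** * The K-functional and the integrand of the interpolation norm *)

Section K_functional.
Context (R : realType) (X0 X1 : completeNormedModType R) (V : lmodType R).
Variables (j0 : {linear X0 -> V}) (j1 : {linear X1 -> V}).

Lemma K_functional_ge0 t a : 0 <= t -> 0 <= K_functional j0 j1 t a.
Proof.
move=> t0; rewrite /K_functional; set S := (X in inf X).
have S0 : lbound S 0.
  by move=> _ [u _ <-]; rewrite addr_ge0// mulr_ge0.
have [/lb_le_inf->//|/set0P/negP/negPn/eqP S00] := pselect (S !=set0).
by rewrite S00 inf0.
Qed.

Lemma K_functional_le t u : 0 <= t ->
  K_functional j0 j1 t (j0 u.1 + j1 u.2) <= `|u.1| + t * `|u.2|.
Proof.
move=> t0; apply: ge_inf; last by exists u.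
by exists 0 => _ [v _ <-]; rewrite addr_ge0// mulr_ge0.
Qed.

Lemma le_K_functional t a x : sum_space j0 j1 a ->
  (forall u, j0 u.1 + j1 u.2 = a -> x <= `|u.1| + t * `|u.2|) ->
  x <= K_functional j0 j1 t a.
Proof.
move=> [u _ ua] xle; apply: lb_le_inf; first by exists (`|u.1| + t * `|u.2|), u.
by move=> _ [v va <-]; exact: xle.
Qed.

Lemma K_functional_homo s t a : 0 <= s -> s <= t -> sum_space j0 j1 a ->
  K_functional j0 j1 s a <= K_functional j0 j1 t a.
Proof.
move=> s0 st ea; apply: le_K_functional => // u <-.
by apply: le_trans (K_functional_le _ _ s0) _; rewrite lerD2l ler_wpM2r.
Qed.

(** The K-functional is monotone in t >= 0, hence measurable. *)
Lemma measurable_interp_integrand theta p a : sum_space j0 j1 a ->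
  measurable_fun (`]0, +oo[%classic : set R) (fun t : R =>
    ((t `^ (- theta) * K_functional j0 j1 t a) `^ p / t)%:E).
Proof.
move=> ea; apply/measurable_EFinP.
(* For t < 0 the infimum may be over a set without lower bound, which breaks
   monotonicity; freezing the functional at 0 there makes it monotone on R. *)
apply: (@eq_measurable_fun _ _ _ _ _ (fun t : R =>
  ((t `^ (- theta) * K_functional j0 j1 (Num.max 0 t) a) `^ p * t `^ (- 1)))).
  move=> t; rewrite inE/= in_itv/= andbT => t0.
  by rewrite (powR_inv1 (ltW t0)) (max_r (ltW t0)).
apply: measurable_funTS.
apply: measurable_funM => //.
apply: (measurableT_comp (measurable_powR _)) => //.
apply: measurable_funM => //.
apply: nondecreasing_measurable => // s t st.
apply: K_functional_homo => //; first by rewrite le_max lexx.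
by rewrite ge_max le_max lexx/= le_max st orbT.
Qed.

Lemma interp_integrand_ge0 theta p a t : 0 < t ->
  (0 <= ((t `^ (- theta) * K_functional j0 j1 t a) `^ p / t)%:E)%E.
Proof. by move=> t0; rewrite lee_fin divr_ge0 ?powR_ge0// ltW. Qed.

End K_functional.

(** * Transfer of decompositions between two couples *)

Lemma powR_perturb (R : realType) (m r h : R) : 0 <= m -> 0 < r -> 0 < h ->
  exists m', [/\ 0 < m', m <= m' & m' `^ r = m `^ r + h].
Proof.
move=> m0 r0 h0.
have m_h : 0 < m `^ r + h by rewrite ltr_wpDl ?powR_ge0.
exists ((m `^ r + h) `^ r^-1); split.
- exact: powR_gt0.
- rewrite -[leLHS]powRr1// -(divff (lt0r_neq0 r0)) powRrM.
  apply: ge0_ler_powR.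
  + by rewrite invr_ge0 ltW.
  + by rewrite nnegrE powR_ge0.
  + by rewrite nnegrE ltW.
  + by rewrite lerDl ltW.
- by rewrite -powRrM mulVf ?gt_eqF// powRr1// ltW.
Qed.

Section interpolation.
Context (R : realType).
Context (X0 X1 : completeNormedModType R) (V : lmodType R).
Variables (i0 : {linear X0 -> V}) (i1 : {linear X1 -> V}).
Context (Y0 Y1 : completeNormedModType R) (W : lmodType R).
Variables (j0 : {linear Y0 -> W}) (j1 : {linear Y1 -> W}).
Variables (a : V) (b : W).

(** What remains of an operator once an argument a and its value b are fixed.
The components of v need not be images of those of u under a common map, which
is why a nonlinear operator can satisfy this. *)
Definition transfers (m0 m1 : R) := forall u : X0 * X1, i0 u.1 + i1 u.2 = a ->
  exists v : Y0 * Y1, [/\ j0 v.1 + j1 v.2 = b,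
    `|v.1| <= m0 * `|u.1| & `|v.2| <= m1 * `|u.2|].

Hypothesis sum_a : sum_space i0 i1 a.

Lemma transfers_sum_space m0 m1 : transfers m0 m1 -> sum_space j0 j1 b.
Proof. by case: sum_a => u _ /[swap] /[apply] -[v [vb _ _]]; exists v. Qed.

(** Factoring m0 out of m0 |u0| + t m1 |u1| leaves |u0| + (t m1 / m0) |u1|. *)
Lemma transfers_K m0 m1 t : 0 < m0 -> 0 <= m1 -> 0 <= t ->
  transfers m0 m1 ->
  K_functional j0 j1 t b <= m0 * K_functional i0 i1 (m1 / m0 * t) a.
Proof.
move=> m00 m10 t0 tr; rewrite -ler_pdivrMl//.
apply: le_K_functional => // u /tr[v [<- v0 v1]].
rewrite ler_pdivrMl//; apply: le_trans; first exact: K_functional_le.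
have -> : m0 * (`|u.1| + m1 / m0 * t * `|u.2|) =
    m0 * `|u.1| + t * (m1 * `|u.2|) by field; rewrite gt_eqF.
by rewrite lerD// ler_wpM2l.
Qed.

Variables (theta p : R).
Hypothesis theta01 : 0 < theta < 1.
Hypothesis p0 : 0 < p.

(** Dilation by c = m1 / m0 in the integral of the p-th power of the norm of a;
the constant is m0^(1-theta) m1^theta = m0 c^theta. *)
Lemma interp_norm_transfers_gt0 m0 m1 : 0 < m0 -> 0 < m1 -> transfers m0 m1 ->
  (interp_norm j0 j1 theta p b <=
   (m0 `^ (1 - theta) * m1 `^ theta)%:E * interp_norm i0 i1 theta p a)%E.
Proof.
move=> m00 m10 tr.
set M := m0 `^ _ * _; have M0 : 0 <= M by rewrite mulr_ge0// powR_ge0.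
pose c := m1 / m0; have c0 : 0 < c by rewrite divr_gt0.
have ME : M = m0 * c `^ theta.
  rewrite /M /c powRM ?invr_ge0 ?ltW// -powR_inv1 ?ltW// -powRrM mulN1r.
  rewrite powRD; last by apply/implyP => _; rewrite gt_eqF.
  by rewrite powRr1 ?ltW// -mulrA [_ * m1 `^ _]mulrC.
rewrite /interp_norm.
set f := fun t : R => ((t `^ (- theta) * K_functional i0 i1 t a) `^ p / t)%:E.
have mf : measurable_fun (`]0, +oo[%classic : set R) f.
  exact: measurable_interp_integrand.
have f0 t : 0 < t -> (0 <= f t)%E by exact: interp_integrand_ge0.
have If0 : (0 <= \int[lebesgue_measure]_(t in `]0%R, +oo[) f t)%E.
  by apply: integral_ge0 => t /=; rewrite in_itv/= andbT; exact: f0.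
have mfc : measurable_fun (`]0, +oo[%classic : set R) (fun t => f (c * t)).
  apply: (@measurable_comp _ _ _ _ _ _ (`]0, +oo[%classic : set R) f) => //.
  by move=> _ [t] /= + <-; rewrite !in_itv/= !andbT; exact: mulr_gt0.
have fc0 (t : R) : 0 < t -> (0 <= f (c * t)%R)%E.
  by move=> t0; rewrite f0 // mulr_gt0.
(* With M under the p-th root as well, it suffices to compare the integrals. *)
have -> : M%:E = ((M `^ p)%:E `^ p^-1)%E.
  by rewrite poweR_EFin -powRrM divff ?gt_eqF// powRr1.
rewrite -poweRM ?lee_fin ?powR_ge0//.
apply: gt0_ler_poweR.
- by rewrite invr_ge0 ltW.
- rewrite in_itv/= leey andbT; apply: integral_ge0 => t /=.
  by rewrite in_itv/= andbT; exact: interp_integrand_ge0.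
- by rewrite in_itv/= leey andbT mule_ge0// lee_fin powR_ge0.
rewrite -(ge0_integral_dilate _ _ c0 mf f0) -ge0_integralZl//; last 2 first.
- by move=> t /=; rewrite in_itv/= andbT; exact: fc0.
- by rewrite lee_fin ltW.
rewrite -ge0_integralZl//; last 3 first.
- exact: measurable_funeM.
- move=> t /=; rewrite in_itv/= andbT => t0.
  by rewrite mule_ge0 ?fc0// lee_fin ltW.
- by rewrite lee_fin powR_ge0.
apply: ge0_le_integral => //.
- by move=> t /=; rewrite in_itv/= andbT; exact: interp_integrand_ge0.
- by apply: measurable_interp_integrand; exact: (transfers_sum_space _ _ tr).
- by do 2 apply: measurable_funeM.
(* The integrands compare pointwise: the factor c of the dilation and the
   denominator c * t combine to 1 / t: this is the invariance of dt / t. *)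
move=> t /=; rewrite in_itv/= andbT => t0.
have ct0 : 0 < c * t by rewrite mulr_gt0.
rewrite /f -!EFinM lee_fin.
rewrite [X in _ <= _ * X](_ : _ =
  ((c * t) `^ (- theta) * K_functional i0 i1 (c * t) a) `^ p / t); last first.
  by field; rewrite !gt_eqF.
have Ka0 := K_functional_ge0 _ _ _ _ i0 i1 _ a (ltW ct0).
have Kb0 := K_functional_ge0 _ _ _ _ j0 j1 _ b (ltW t0).
rewrite mulrA ler_pM2r ?invr_gt0// -powRM//; last first.
  by rewrite mulr_ge0 ?powR_ge0.
have -> : M * ((c * t) `^ (- theta) * K_functional i0 i1 (c * t) a) =
    t `^ (- theta) * (m0 * K_functional i0 i1 (c * t) a).
  rewrite ME [(c * t) `^ _]powRM ?ltW// (powRN c).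
  have : c `^ theta != 0 by rewrite powR_eq0 gt_eqF.
  move: (c `^ theta) => x x0.
  by rewrite -!mulrA mulVKf// mulrCA.
apply: ge0_ler_powR; first exact: ltW.
- by rewrite nnegrE mulr_ge0 ?powR_ge0.
- by rewrite nnegrE mulr_ge0 ?powR_ge0// mulr_ge0// ltW.
by rewrite ler_wpM2l ?powR_ge0// /c; apply: transfers_K => //; exact: ltW.
Qed.

Lemma le_transfers m0 m1 m0' m1' : m0 <= m0' -> m1 <= m1' ->
  transfers m0 m1 -> transfers m0' m1'.
Proof.
move=> m00' m11' tr u /tr[v [vb v0 v1]]; exists v; split=> //.
- by rewrite (le_trans v0)// ler_wpM2r.
- by rewrite (le_trans v1)// ler_wpM2r.
Qed.

(** Only the powers m0^(1-theta) and m1^theta enter the bound, so these are what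
is increased, by the same small h, and the two factors become x + h and y + h.
Finiteness of the norm of a makes the resulting error tend to 0 with h. *)
Lemma interp_norm_transfers m0 m1 : 0 <= m0 -> 0 <= m1 -> transfers m0 m1 ->
  (interp_norm i0 i1 theta p a < +oo)%E ->
  (interp_norm j0 j1 theta p b <=
   (m0 `^ (1 - theta) * m1 `^ theta)%:E * interp_norm i0 i1 theta p a)%E.
Proof.
move=> m00 m10 tr; have /andP[theta0 theta1] := theta01.
have : (0 <= interp_norm i0 i1 theta p a)%E by exact: poweR_ge0.
case E : interp_norm => [n| |]//; rewrite lee_fin => n0 _.
set x := m0 `^ _; set y := m1 `^ _.
have x0 : 0 <= x by exact: powR_ge0.
have y0 : 0 <= y by exact: powR_ge0.
apply/lee_addgt0Pr => e e0.
(* For h <= 1, (x + h) (y + h) n exceeds x y n by at most h (x + y + 1) n; the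
   final + 1 in C only ensures that C > 0. *)
pose C := (x + y + 1) * n + 1.
have C0 : 0 < C by rewrite ltr_wpDl// mulr_ge0// addr_ge0// addr_ge0.
pose h := Num.min 1 (e / C).
have h0 : 0 < h by rewrite lt_min ltr01 divr_gt0.
have h1 : h <= 1 by rewrite ge_min lexx.
have hC : h * C <= e by rewrite -ler_pdivlMr// ge_min lexx orbT.
have [|||m0' [m0'0 m00' m0'E]] := @powR_perturb R m0 (1 - theta) h => //.
  by rewrite subr_gt0.
have [|||m1' [m1'0 m11' m1'E]] := @powR_perturb R m1 theta h => //.
have tr' := le_transfers _ _ _ _ m00' m11' tr.
have := interp_norm_transfers_gt0 _ _ m0'0 m1'0 tr'.
rewrite E m0'E m1'E -/x -/y => /le_trans; apply.
rewrite -!EFinM -EFinD lee_fin.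
apply: (@le_trans _ _ (x * y * n + h * C)); last by rewrite lerD2l.
rewrite -subr_ge0 (_ : _ - _ = h * (1 - h) * n + h); last by rewrite /C; ring.
by rewrite addr_ge0 ?(ltW h0)// !mulr_ge0 ?subr_ge0 ?(ltW h0).
Qed.

End interpolation.

Arguments transfers {R X0 X1 V} i0 i1 {Y0 Y1 W} j0 j1 a b m0 m1.
Arguments transfers_sum_space {R X0 X1 V i0 i1 Y0 Y1 W j0 j1 a b}
  sum_a {m0 m1} tr.
Arguments interp_norm_transfers {R X0 X1 V i0 i1 Y0 Y1 W j0 j1 a b}
  sum_a {theta p} theta01 p0 {m0 m1}.


(** * Multiplication in L^0 *)

Section L0_algebra.
Context d (T : measurableType d) (R : realType).
Variable mu : {measure set T -> \bar R}.

Lemma L0_mulDl (f g h : L0 mu) : L0_mul (f + g) h = L0_mul f h + L0_mul g h.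
Proof.
apply: L0_ext; near=> x.
have -> : L0_mul (f + g) h x = L0_add f g x * h x.
  by near: x; exact: L0_mulE.
have -> : L0_add f g x = f x + g x by near: x; exact: L0_addE.
have -> : (L0_mul f h + L0_mul g h : L0 mu) x = L0_mul f h x + L0_mul g h x.
  by near: x; exact: L0_addE.
have -> : L0_mul f h x = f x * h x by near: x; exact: L0_mulE.
have -> : L0_mul g h x = g x * h x by near: x; exact: L0_mulE.
by rewrite mulrDl.
Unshelve. all: by end_near. Qed.

Lemma L0_mul_indicT (f : L0 mu) : L0_mul f (L0_indic mu measurableT) = f.
Proof.
apply: L0_ext.
apply: filterS2 (L0_mulE f (L0_indic mu measurableT))
  (L0_classK mu (mindic R measurableT)) => x -> ->.
by rewrite mindicE -[X in _ * X]/(\1_[set: T] x) indicT mulr1.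
Qed.

End L0_algebra.

(** * Interpolation of the operator *)

Theorem proposition5p3 (R : realType) (d : measure_display)
    (Omega : measurableType d) (mu : {finite_measure set Omega -> \bar R})
    (E0 E1 : completeNormedModType R) (i : {linear E0 -> E1})
    (Y0 Y1 : completeNormedModType R)
    (j0 : {linear Y0 -> L0 mu}) (j1 : {linear Y1 -> L0 mu})
    (hY0 : banach_function_space j0) (hY1 : banach_function_space j1)
    (hE : banach_couple i (idfun : {linear E1 -> E1}))
    (hY : banach_couple j0 j1)
    (phi0 phi1 : set Omega -> R)
    (hphi0 : increasing_set_function phi0)
    (hphi1 : increasing_set_function phi1)
    (T : E1 -> Y1)
    (hTE0 : forall x : E0, range j0 (j1 (T (i x))))
    (ha : forall (A : set Omega) (mA : measurable A) (x : E0),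
      norm_le j0 (L0_mul (j1 (T (i x))) (L0_indic mu mA)) (phi0 A * `|x|))
    (hb : forall (A : set Omega) (mA : measurable A) (x y : E1),
      norm_le j1 (L0_mul (j1 (T x - T y)) (L0_indic mu mA))
        (phi1 A * `|x - y|))
    (theta p : R) (htheta : 0 < theta < 1) (hp : 1 <= p) :
  (forall x : E1,
    interp_space i (idfun : {linear E1 -> E1}) theta p x ->
    interp_space j0 j1 theta p (j1 (T x))) /\
  (forall (x : E1) (A : set Omega) (mA : measurable A),
    interp_space i (idfun : {linear E1 -> E1}) theta p x ->
    interp_space j0 j1 theta p (L0_mul (j1 (T x)) (L0_indic mu mA)) /\
    (interp_norm j0 j1 theta p (L0_mul (j1 (T x)) (L0_indic mu mA)) <=
      (phi0 A `^ (1 - theta) * phi1 A `^ theta)%:E *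
      interp_norm i (idfun : {linear E1 -> E1}) theta p x)%E).
Proof.
have main (x : E1) (A : set Omega) (mA : measurable A) :
    interp_space i (idfun : {linear E1 -> E1}) theta p x ->
    interp_space j0 j1 theta p (L0_mul (j1 (T x)) (L0_indic mu mA)) /\
    (interp_norm j0 j1 theta p (L0_mul (j1 (T x)) (L0_indic mu mA)) <=
      (phi0 A `^ (1 - theta) * phi1 A `^ theta)%:E *
      interp_norm i (idfun : {linear E1 -> E1}) theta p x)%E.
  move=> [sum_x fin_x].
  have tr : transfers i (idfun : {linear E1 -> E1}) j0 j1 x
      (L0_mul (j1 (T x)) (L0_indic mu mA)) (phi0 A) (phi1 A).
    move=> [x0 x1]/= xE.
    (* T x = T (i x0) + (T x - T (i x0)), and x - i x0 = x1. *)
    have [y0 y0E y0le] := ha A mA x0.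
    have [y1 y1E y1le] := hb A mA x (i x0).
    exists (y0, y1) => /=; split => //.
      by rewrite y0E y1E -L0_mulDl -raddfD/= addrC subrK.
    by move: y1le; rewrite -[in x - _]xE addrAC subrr add0r.
  have le_norm := interp_norm_transfers sum_x htheta
    (lt_le_trans ltr01 hp) (hphi0.1 _ mA) (hphi1.1 _ mA) tr fin_x.
  have sum_Tx := transfers_sum_space sum_x tr.
  split; last exact: le_norm.
  split; first exact: sum_Tx.
  apply: le_lt_trans le_norm _; apply: lte_mul_pinfty; last exact: fin_x.
  - by rewrite lee_fin mulr_ge0 ?powR_ge0.
  - by [].
split; last exact: main.
move=> x /(main x _ measurableT)[+ _].
by rewrite L0_mul_indicT.
Qed.
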